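(* Let $X$ be a set, let $B(X)$ be the space of all bounded real-valued functions on $X$, and let $\{f_n : n\in\mathbb{N}\}\subseteq B(X)$ be a uniformly bounded sequence. The following are equivalent: (i) $\{f_n\}_n$ weakly d-converges to $0$; (ii) for any sequence $\{x_k : k\in\mathbb{N}\}$ in $X$, $\;d\lim_{n\to\infty}\,\liminf_{k\to\infty}|f_n(x_k)|=0$.
   Context: For $I\subseteq\mathbb{N}$, the upper asymptotic density of $I$ is $\bar{d}(I)=\limsup_{n\to\infty}\frac{|I\cap\{1,2,\dots,n\}|}{n}$, where $|\cdot|$ of a finite set denotes its cardinality. For a real sequence $(a_n)_{n\in\mathbb{N}}$ and $L\in\mathbb{R}$, write $d\lim_{n\to\infty} a_n=L$ provided it is not the case that there are an $r>0$ and a set $I\subseteq\mathbb{N}$ with $\bar{d}(I)>0$ such that $|a_n-L|>r$ for all $n\in I$. A linear functional $T:B(X)\to\mathbb{R}$ is positive if $T(g)\ge 0$ whenever $g\in B(X)$ and $g\ge 0$ pointwise. A sequence $\{f_n\}_n$ in $B(X)$ weakly d-converges to $0$ provided that for every positive linear functional $T$ on $B(X)$, $d\lim_{n\to\infty}T(f_n)=0$. Uniformly bounded means there is $M>0$ with $|f_n(x)|\le M$ for all $n\in\mathbb{N}$ and $x\in X$. *)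

(* Defs.v *)
From HB Require Import structures.
From mathcomp Require Import all_boot all_order all_algebra finmap.
From mathcomp Require Import all_classical all_reals all_analysis.

Set Implicit Arguments.
Unset Strict Implicit.
Unset Printing Implicit Defensive.

Import Order.TTheory GRing.Theory Num.Theory.
Import numFieldNormedType.Exports.

Local Open Scope classical_set_scope.
Local Open Scope ring_scope.

Section BoundedFunctions.
Context (X : Type) (R : realType).

Definition bounded_pred : {pred X -> R} := mem (bounded_fun : set (X -> R)).

(* The space B(X); it inherits the pointwise operations of [X -> R]. *)
Record bfun := BFun { bfun_val :> X -> R; _ : bfun_val \in bounded_pred }.

HB.instance Definition _ := [isSub for bfun_val].
HB.instance Definition _ := [Choice of bfun by <:].

Lemma bounded_predP (f : X -> R) :
  reflect (exists M, forall x, `|f x| <= M) (f \in bounded_pred).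
Proof.
apply: (iffP idP) => [|[M fM]]; rewrite inE.
  by move=> /pinfty_ex_gt0[M _ fM]; exists M => x; exact: fM.
exists M; split; first exact: num_real.
by move=> N /ltW MN x _; exact: le_trans (fM x) MN.
Qed.

Lemma bounded_pred_submod_closed : submod_closed bounded_pred.
Proof.
split=> [|a f g /bounded_predP[M fM] /bounded_predP[N gN]]; apply/bounded_predP.
  by exists 0 => x; rewrite normr0.
exists (`|a| * M + N) => x.
by rewrite (le_trans (ler_normD _ _))// normrM lerD// ler_wpM2l.
Qed.

HB.instance Definition _ :=
  GRing.isSubmodClosed.Build _ _ bounded_pred bounded_pred_submod_closed.
HB.instance Definition _ := [SubChoice_isSubLmodule of bfun by <:].

End BoundedFunctions.

Section Density.
Context (R : realType).

(* The value at [n = 0] is the junk [0 / 0 = 0], irrelevant to the limsup, as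
   is whether [0] belongs to [I]. The sequence takes values in [0, 1], so that
   [limn_sup] is the true limit superior. *)
Definition upper_density (I : set nat) : R :=
  limn_sup (fun n : nat =>
    #|` fset_set (I `&` [set k | (1 <= k <= n)%N])|%:R / n%:R : R).

Definition has_dlim (a : nat -> R) (L : R) : Prop :=
  ~ exists (r : R) (I : set nat),
      [/\ 0 < r, 0 < upper_density I & forall n, I n -> r < `|a n - L|].

End Density.

Section WeakConvergence.
Context (X : Type) (R : realType).

Definition positive_functional (T : {scalar bfun X R}) : Prop :=
  forall g : bfun X R, (forall x, 0 <= g x) -> 0 <= T g.

Definition weakly_dcvg0 (f : nat -> bfun X R) : Prop :=
  forall T : {scalar bfun X R}, positive_functional T ->
    has_dlim (fun n => T (f n)) 0.

Definition uniformly_bounded (f : nat -> bfun X R) : Prop :=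
  exists2 M : R, 0 < M & forall n x, `|f n x| <= M.

End WeakConvergence.

(* Main.v *)
From HB Require Import structures.
Require Import Defs.
From mathcomp Require Import all_boot all_order all_algebra finmap.
From mathcomp Require Import all_classical all_reals all_analysis.
From mathcomp Require Import lra.

Set Implicit Arguments.
Unset Strict Implicit.
Unset Printing Implicit Defensive.

Import Order.TTheory GRing.Theory Num.Theory.
Import numFieldNormedType.Exports.
Local Open Scope classical_set_scope.
Local Open Scope ring_scope.

(** The bridge between positive functionals on B(X) and sequences of points is
    the notion of ultrafilter.

    Weak convergence implies the condition on sequences because every sequence
    [x] of points defines positive functionals: fix an ultrafilter [U] on the
    indices containing all tails and let [ultra_eval U x g] be the limit of
    [g (x k)] along [U], which exists since [g] is bounded. If the lower limit
    of [`|f n (x k)|] exceeds [r], then [`|f n (x k)| > r] for U-many [k], so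
    [`|ultra_eval U x (f n)| >= r].

    For the converse, a positive functional [T] is integration against a
    finitely additive measure, and the argument follows the proof of
    Bergelson's intersectivity lemma. Suppose
    [`|T (f n)| > r] for all [n] in a set of positive upper density. Then the
    averages [cesaro_abs f N] of [`|f 1|, ..., `|f N|] satisfy
    [T (cesaro_abs f N) >= delta] for infinitely many [N] and some [delta > 0].
    For a countably additive measure, the reverse Fatou lemma would provide a
    point at which infinitely many averages are at least some [eta > 0].
    Finite additivity only provides an ideal point, that is, an ultrafilter [p]
    on [X] (lemma [positive_functional_reverse_fatou]). At such a point the
    Cesaro bound says that the [n] for which [`|f n| > eta / 2] on a set of [p]
    form a set of positive upper density ([ultra_indices_density_gt0]). Finitely
    many of these sets always have a common point, so choosing [x k] in the
    intersection of those with index at most [k] gives a sequence along which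
    [`|f n (x k)|] is eventually greater than [eta / 2] for each such [n]
    ([ultra_indices_seq]). *)

(** * Filters *)

Lemma filter_forall_leq (T : Type) (F : set_system T) (A : nat -> set T)
    (N : nat) : Filter F ->
  (forall n, (n <= N)%N -> F (A n)) ->
  F [set x | forall n, (n <= N)%N -> A n x].
Proof.
move=> FF FA.
have FAi (i : 'I_N.+1) : F (A i) by apply: FA; rewrite -ltnS.
have := filter_forall (f := fun i : 'I_N.+1 => A i) FF FAi.
apply: filterS => x Ax n nN.
by have := Ax (Ordinal (nN : (n < N.+1)%N)).
Qed.

Lemma ultra_exists_leq (T : Type) (F : set_system T) (A : nat -> set T)
    (k l : nat) : UltraFilter F ->
  F [set x | exists2 j, (k <= j <= l)%N & A j x] ->
  exists2 j, (k <= j <= l)%N & F (A j).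
Proof.
move=> FU FE; apply: contrapT => nA.
have FC n : (n <= l)%N -> F [set x | (k <= n)%N -> ~ A n x].
  move=> nl; have [kn|nk] := leqP k n; last by apply: nearW.
  case: (in_ultra_setVsetC (A n) FU) => [FAn|].
    by case: nA; exists n => //; rewrite kn.
  by apply: filterS => x /=.
have [x [[j /andP[kj jl] Ajx] /(_ j jl kj)]] :=
  filter_ex (filterI FE (filter_forall_leq _ FC)).
by [].
Qed.

(** * Upper limits and upper density *)

Section LimSup.
Context {R : realType}.
Implicit Types (u : R^o^nat) (I : set nat).

Lemma limn_sup_frequently_gt u (c : R) : bounded_fun u -> c < limn_sup u ->
  forall k, exists2 n, (k <= n)%N & c < u n.
Proof.
move=> ub; rewrite limn_supE// => cu k.
have /(lt_le_trans cu) : inf (range (sups u)) <= sups u k.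
  by apply: ge_inf; [exact: bounded_fun_has_lbound_sups|exists k].
have ne : sdrop u k !=set0 by exists (u k); exists k => /=.
by move=> /(sup_gt ne)[_ [n kn <-] cun]; exists n.
Qed.

Lemma limn_sup_ge_frequently u (c : R) : bounded_fun u ->
  (forall k, exists2 n, (k <= n)%N & c <= u n) -> c <= limn_sup u.
Proof.
move=> ub cu; rewrite limn_supE//; apply: lb_le_inf.
  by exists (sups u 0%N); exists 0%N.
move=> _ [k _ <-]; have [n kn /le_trans] := cu k; apply.
apply: ub_le_sup; last by exists n.
exact/has_ubound_sdrop/bounded_fun_has_ubound.
Qed.

Lemma limn_inf_gt_eventually u (c : R) : bounded_fun u -> c < limn_inf u ->
  \forall k \near \oo, c < u k.
Proof.
move=> ub; rewrite limn_infE// => /sup_gt[].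
  by exists (infs u 0%N); exists 0%N.
move=> _ [k _ <-] cu; exists k => // n /= kn; apply: (lt_le_trans cu).
apply: ge_inf; last by exists n.
exact/has_lbound_sdrop/bounded_fun_has_lbound.
Qed.

Lemma limn_inf_ge_eventually u (c : R) : bounded_fun u ->
  (\forall k \near \oo, c <= u k) -> c <= limn_inf u.
Proof.
move=> ub [k _ cu]; rewrite limn_infE//.
apply: (@le_trans _ _ (infs u k)).
  apply: lb_le_inf; first by exists (u k); exists k => /=.
  by move=> _ [n /= kn <-]; exact: cu.
by apply: ub_le_sup; [exact: bounded_fun_has_ubound_infs|exists k].
Qed.

Lemma bounded_fun_norm_le (T : Type) (u : T -> R^o) (M : R) :
  (forall k, `|u k| <= M) -> bounded_fun u.
Proof.
move=> uM; exists M; split; first exact: num_real.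
by move=> N /ltW MN x _; exact: le_trans (uM x) MN.
Qed.

(** At [n = 0] this is [0 / 0 = 0], as in the definition of the upper density.
    Writing the count as a sum of indicators lets it be compared termwise with
    sums of values of functions. *)
Definition freq I (n : nat) : R := (\sum_(1 <= k < n.+1) (k \in I)%:R) / n%:R.

Lemma upper_densityE I : upper_density R I = limn_sup (freq I : R^o^nat).
Proof.
rewrite /upper_density; congr limn_sup; apply/funext => n; congr (_ / _).
rewrite -natr_sum; congr _%:R.
have -> : fset_set (I `&` [set k | (1 <= k <= n)%N]) =
    [fset k in [seq k <- index_iota 1 n.+1 | k \in I]]%fset.
  apply/fsetP => k; rewrite in_fset_set.
    rewrite in_fset_ /= mem_filter mem_index_iota ltnS in_setI; congr (_ && _).
    by apply/idP/idP; rewrite inE.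
  by apply: finite_setIr; apply: (sub_finite_set _ (finite_II n.+1)) => j /= /andP[].
rewrite card_fseq undup_id ?filter_uniq ?iota_uniq// size_filter -sum1_count.
by rewrite big_mkcond; apply: eq_bigr => k _; case: (k \in I).
Qed.

Lemma freq_bounded I n : `|freq I n| <= 1.
Proof.
have S0 : 0 <= \sum_(1 <= k < n.+1) (k \in I)%:R :> R by exact: sumr_ge0.
rewrite ger0_norm ?divr_ge0//; case: n S0 => [|n] S0.
  by rewrite /freq invr0 mulr0.
rewrite ler_pdivrMr// mul1r.
apply: le_trans (_ : \sum_(1 <= k < n.+2) 1 <= _).
  by apply: ler_sum => k _; case: (k \in I).
by rewrite sumr_const_nat subn1.
Qed.

Lemma upper_density_gt0P I : 0 < upper_density R I <->
  exists2 d : R, 0 < d & forall k, exists2 n, (k <= n)%N & d <= freq I n.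
Proof.
rewrite upper_densityE; have bf := bounded_fun_norm_le (freq_bounded I).
split=> [I0|[d d0 /(limn_sup_ge_frequently bf)]]; last exact: lt_le_trans.
exists (limn_sup (freq I : R^o^nat) / 2); first by rewrite divr_gt0.
move=> k; have lt2 : limn_sup (freq I : R^o^nat) / 2 < limn_sup (freq I : R^o^nat).
  by move: I0; lra.
by have [n kn /ltW] := limn_sup_frequently_gt bf lt2 k; exists n.
Qed.

End LimSup.

(** * The lattice of bounded functions *)

Section BoundedFunctionLattice.
Context {X : Type} {R : realType}.
Implicit Types g h : bfun X R.

Lemma bfun_bounded g : exists M, forall x, `|g x| <= M.
Proof. by apply/bounded_predP; exact: valP. Qed.

Fact babs_subproof g : (fun x => `|g x|) \in @bounded_pred X R.
Proof.
by have [M gM] := bfun_bounded g; apply/bounded_predP; exists M => x; rewrite normr_id.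
Qed.
Definition babs g : bfun X R := BFun (babs_subproof g).

Fact bmax_subproof g h : (fun x => Num.max (g x) (h x)) \in @bounded_pred X R.
Proof.
have [M gM] := bfun_bounded g; have [N hN] := bfun_bounded h.
apply/bounded_predP; exists (Num.max M N) => x.
by case: (leP (g x)) => _; rewrite le_max ?gM ?hN ?orbT.
Qed.
Definition bmax g h : bfun X R := BFun (bmax_subproof g h).

Fact bmin_subproof g h : (fun x => Num.min (g x) (h x)) \in @bounded_pred X R.
Proof.
have [M gM] := bfun_bounded g; have [N hN] := bfun_bounded h.
apply/bounded_predP; exists (Num.max M N) => x.
by case: (leP (g x)) => _; rewrite le_max ?gM ?hN ?orbT.
Qed.
Definition bmin g h : bfun X R := BFun (bmin_subproof g h).

Fact bcst_subproof (c : R) : (fun=> c) \in @bounded_pred X R.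
Proof. by apply/bounded_predP; exists `|c|. Qed.
Definition bcst (c : R) : bfun X R := BFun (bcst_subproof c).

Lemma bfun_eqP g h : (forall x, g x = h x) -> g = h.
Proof. by move=> gh; apply/val_inj/funext. Qed.

Lemma bmax_add_bmin g h : bmax g h + bmin g h = g + h.
Proof. by apply: bfun_eqP => x; exact: addr_max_min. Qed.

Lemma bcstE (c : R) : bcst c = c *: bcst 1.
Proof. by apply: bfun_eqP => x; exact: esym (mulr1 c). Qed.

Lemma bfun_sumE (I : Type) (r : seq I) (F : I -> bfun X R) (x : X) :
  (\sum_(i <- r) F i) x = \sum_(i <- r) F i x.
Proof. exact: (big_morph (fun g : bfun X R => g x)). Qed.

Definition cesaro_abs (f : nat -> bfun X R) (n : nat) : bfun X R :=
  n%:R^-1 *: \sum_(1 <= k < n.+1) babs (f k).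

Lemma cesaro_absE f n x :
  cesaro_abs f n x = (\sum_(1 <= k < n.+1) `|f k x|) / n%:R.
Proof.
rewrite mulrC; transitivity (n%:R^-1 * (\sum_(1 <= k < n.+1) babs (f k)) x) => //.
by rewrite bfun_sumE.
Qed.

Section PositiveFunctional.
Context {T : {scalar bfun X R}} (posT : positive_functional T).

Lemma positive_functional_le g h : (forall x, g x <= h x) -> T g <= T h.
Proof.
move=> gh; rewrite -subr_ge0 -linearB; apply: posT => x.
rewrite (_ : _ x = h x - g x) ?subr_ge0//.
Qed.

Lemma positive_functional_bcst (c : R) : T (bcst c) = c * T (bcst 1).
Proof. by rewrite bcstE linearZ. Qed.

Lemma positive_functional_abs g : `|T g| <= T (babs g).
Proof.
rewrite ler_norml -linearN; apply/andP; split; apply: positive_functional_le => x.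
  by rewrite lerNl; apply: (le_trans (ler_norm _)); rewrite normrN.
exact: ler_norm.
Qed.

End PositiveFunctional.
End BoundedFunctionLattice.

(** * A reverse Fatou lemma for positive functionals *)

Section ReverseFatou.
Context {X : Type} {R : realType} {T : {scalar bfun X R}}.
Hypothesis posT : positive_functional T.
Variables (g : nat -> bfun X R) (M delta : R).
Hypotheses (gM : forall k x, g k x <= M) (delta0 : 0 < delta).
Hypothesis Tg : forall k, exists2 j, (k <= j)%N & delta <= T (g j).

(** The functions lying below the maximum of some finite block
    [g k, ..., g l] of the tail. They replace the suprema of tails, on which
    [T] need not be continuous. *)
Definition tail_dominated (k : nat) (h : bfun X R) : Prop :=
  exists l, forall x, exists2 j, (k <= j <= l)%N & h x <= g j x.

Lemma tail_dominated_mem k j : (k <= j)%N -> tail_dominated k (g j).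
Proof. by move=> kj; exists j => x; exists j; rewrite ?kj ?leqnn. Qed.

Lemma tail_dominated_le k (h h' : bfun X R) :
  (forall x, h x <= h' x) -> tail_dominated k h' -> tail_dominated k h.
Proof.
move=> hh' [l h'g]; exists l => x; have [j kjl h'j] := h'g x.
by exists j => //; exact: le_trans (hh' x) h'j.
Qed.

Lemma tail_dominatedW k h : tail_dominated k.+1 h -> tail_dominated k h.
Proof.
move=> [l hg]; exists l => x; have [j /andP[kj jl] hj] := hg x.
by exists j => //; rewrite (ltnW kj).
Qed.

Lemma tail_dominated_max k h h' :
  tail_dominated k h -> tail_dominated k h' -> tail_dominated k (bmax h h').
Proof.
move=> [l hg] [l' h'g]; exists (maxn l l') => x /=.
case: (leP (h x) (h' x)) => _.
  have [j /andP[kj jl] hj] := h'g x.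
  by exists j => //; rewrite kj leq_max jl orbT.
have [j /andP[kj jl] hj] := hg x.
by exists j => //; rewrite kj leq_max jl.
Qed.

Lemma tail_dominated_near_sup k (e : R) : 0 < e ->
  exists G, tail_dominated k G /\
    forall h, tail_dominated k h -> T h <= T G + e.
Proof.
move=> e0; pose E := [set T h | h in tail_dominated k].
have supE : has_sup E.
  split; first by exists (T (g k)), (g k) => //; exact: tail_dominated_mem.
  exists (T (bcst M)) => _ [h [l hg] <-]; apply: positive_functional_le => // x.
  by have [j _ /le_trans] := hg x; apply.
have [_ [G kG <-] Ge] := sup_adherent e0 supE; exists G; split=> // h kh.
have : T h <= sup E by apply: ub_le_sup; [exact: (proj2 supE)|exists h].
by move: Ge; lra.
Qed.

(** Choose [G k] dominated by the tail from [k] with [T (G k)] maximal up to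
    [delta / 2 ^ (k + 2)]. As these classes of functions decrease with [k] and
    are closed under maximum, replacing [G k] by [bmax (G k) (G k.+1)] hardly
    increases [T]; by [bmax_add_bmin], taking the minimum with [G k.+1] hardly
    decreases it. Hence [T] of the minimum of [G 0, ..., G k] stays above
    [delta / 2], and a positive functional cannot be that large on a function
    that is small everywhere. *)
Lemma tail_dominated_near_inf_seq : exists G : nat -> bfun X R,
  (forall k, tail_dominated k (G k)) /\
  forall k, exists x, forall i, (i <= k)%N ->
    delta / 4 / (T (bcst 1) + 1) <= G i x.
Proof.
pose e k : R := delta / 2 ^+ k.+1.
have e0 k : 0 < e k by rewrite divr_gt0// exprn_gt0.
have eS k : e k = 2 * e k.+1.
  by rewrite /e [in RHS]exprS invfM mulrCA mulrA -mulrA mulVKf// lt0r_neq0.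
have [G HG] := choice (fun k => tail_dominated_near_sup k (e0 k.+1)).
have GC k := (HG k).1; have Gsup k := (HG k).2.
exists G; split=> // k.
pose m := fix m k := if k is k'.+1 then bmin (m k') (G k'.+1) else G 0%N.
have mG i j x : (i <= j)%N -> m j x <= G i x.
  elim: j => [|j IH]; first by rewrite leqn0 => /eqP->.
  rewrite leq_eqVlt => /predU1P[->|/IH mj]; first by rewrite /= ge_min lexx orbT.
  by rewrite /= ge_min mj.
(* The losses [e 1, ..., e j] add up to [e 0 - e j]. *)
have Tm j : T (G j) + e j <= T (m j) + e 0%N.
  elim: j => [|j IH]; first by [].
  (* [m j] lies below [G j], so the maximum still competes with [G j]. *)
  have : T (bmax (m j) (G j.+1)) <= T (G j) + e j.+1.
    apply: Gsup; apply: tail_dominated_max; last exact/tail_dominatedW.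
    by apply: tail_dominated_le (GC j) => x; exact: mG.
  have : T (bmax (m j) (G j.+1)) + T (m j.+1) = T (m j) + T (G j.+1).
    by rewrite -!linearD bmax_add_bmin.
  by move: IH (eS j); lra.
have TG : delta <= T (G k) + e k.+1.
  have [j kj] := Tg k => /le_trans; apply.
  by apply: Gsup; exact: tail_dominated_mem.
have T1 : 0 <= T (bcst 1) by apply: posT => x /=.
have e00 : e 0%N = delta / 2 by rewrite /e expr1.
apply: contrapT => nx.
have : T (m k) <= T (bcst (delta / 4 / (T (bcst 1) + 1))).
  apply: positive_functional_le => // x; rewrite leNgt; apply/negP => mx.
  by apply: nx; exists x => i /(mG _ _ x); apply: le_trans; exact: ltW.
rewrite positive_functional_bcst.
have : delta / 4 / (T (bcst 1) + 1) * T (bcst 1) <= delta / 4.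
  rewrite -mulrA; apply: ler_piMr; first by rewrite divr_ge0// ltW.
  by rewrite ler_pdivrMl ?mulr1; move: T1; lra.
by move: TG (Tm k) (eS k) (e0 k.+1) e00 delta0; lra.
Qed.

(** The sets where [G 0, ..., G k] are all at least [eta] decrease and are not
    empty, so some ultrafilter contains them. On each of them the maximum of a
    finite block of the tail is at least [eta], and an ultrafilter containing a
    finite union contains one of its terms. *)
Lemma positive_functional_reverse_fatou :
  exists2 eta : R, 0 < eta & exists p : set_system X, UltraFilter p /\
    forall k, exists2 j, (k <= j)%N & p [set x | eta <= g j x].
Proof.
have [G [GC Gx]] := tail_dominated_near_inf_seq.
have T1 : 0 <= T (bcst 1) by apply: posT => x /=.
set eta := delta / 4 / (T (bcst 1) + 1) in Gx.
exists eta; first by rewrite !divr_gt0// ltr_wpDl.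
pose B k := [set x | forall i, (i <= k)%N -> eta <= G i x].
have Bfilter : ProperFilter (filter_from [set: nat] B).
  apply: filter_from_proper => [|k _]; last exact: Gx.
  apply: filter_from_filter; first by exists 0%N.
  move=> i j _ _; exists (maxn i j) => // x Bx; split=> n nk; apply: Bx.
    by rewrite leq_max nk.
  by rewrite leq_max nk orbT.
have [p [pU Bp]] := ultraFilterLemma Bfilter.
exists p; split=> // k; have [l Gl] := GC k.
have : p [set x | exists2 j, (k <= j <= l)%N & eta <= g j x].
  apply: filterS (Bp (B k) _); last by exists k.
  move=> x /(_ k (leqnn k)) Gkx; have [j kjl Gj] := Gl x.
  by exists j => //; exact: le_trans Gj.
move=> /(@ultra_exists_leq _ _ (fun j => [set x | eta <= g j x]))[j /andP[kj _] pj].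
by exists j.
Qed.

End ReverseFatou.

(** * Selecting a dense set of indices and a sequence of points *)

Section UltrafilterSelection.
Context {X : Type} {R : realType} {f : nat -> bfun X R} {M eta : R}.
Hypotheses (M0 : 0 < M) (fM : forall n x, `|f n x| <= M) (eta0 : 0 < eta).
Context {p : set_system X} {pU : UltraFilter p}.

Definition ultra_indices (c : R) : set nat := [set n | p [set x | c < `|f n x|]].

(** A bound on an average of numbers in [0, M] forces many of them to be large.
    The membership in [p] of the finitely many sets involved is realised at a
    single point [x], where the count is made. *)
Lemma ultra_indices_freq N : p [set x | eta <= cesaro_abs f N.+1 x] ->
  eta / 2 / M <= freq (ultra_indices (eta / 2)) N.+1.
Proof.
move=> pN; set J := ultra_indices _.
have pJ n : (n <= N.+1)%N -> p [set x | n \notin J -> `|f n x| <= eta / 2].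
  move=> _; have [nJ|nJ] := boolP (n \in J); first exact: nearW.
  case: (in_ultra_setVsetC [set x | eta / 2 < `|f n x|] pU) => [pn|].
    by move: nJ; rewrite notin_setE => /(_ pn).
  by apply: filterS => x /= /negP; rewrite -leNgt.
have [x [xN Jx]] := filter_ex (filterI pN (filter_forall_leq _ pJ)).
have N0 : 0 < N.+1%:R :> R by [].
have etaN : eta * N.+1%:R <= \sum_(1 <= k < N.+2) `|f k x|.
  by rewrite -ler_pdivlMr// -cesaro_absE.
rewrite ler_pdivrMr// /freq mulrAC ler_pdivlMr//.
suff : \sum_(1 <= k < N.+2) `|f k x| <=
    (\sum_(1 <= k < N.+2) (k \in J)%:R) * M + eta / 2 * N.+1%:R.
  by move: etaN; lra.
rewrite mulr_suml.
have -> : eta / 2 * N.+1%:R = \sum_(1 <= k < N.+2) eta / 2.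
  by rewrite sumr_const_nat subn1 mulr_natr.
rewrite -big_split/= !big_nat; apply: ler_sum => k /andP[_ kN].
have [kJ|kJ] := boolP (k \in J).
  by rewrite mul1r (le_trans (fM k x))// lerDl divr_ge0// ltW.
by rewrite mul0r add0r; exact: Jx.
Qed.

Lemma ultra_indices_density_gt0 :
  (forall k, exists2 j, (k <= j)%N & p [set x | eta <= cesaro_abs f j x]) ->
  0 < upper_density R (ultra_indices (eta / 2)).
Proof.
move=> pf; apply/upper_density_gt0P; exists (eta / 2 / M); first by rewrite !divr_gt0.
(* Asking for an index above [k.+1] discards the degenerate average at [0]. *)
move=> k; have [[//|j] kj pj] := pf k.+1.
by exists j.+1; [exact: ltnW|exact: ultra_indices_freq].
Qed.

(** The sets [{x | c < `|f n x|}] with [n] in [ultra_indices c] have the finite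
    intersection property, all being members of [p]. *)
Lemma ultra_indices_seq (c : R) : exists x : nat -> X,
  forall n, ultra_indices c n -> forall k, (n <= k)%N -> c < `|f n (x k)|.
Proof.
have Fx k : exists x, forall n, (n <= k)%N -> ultra_indices c n -> c < `|f n x|.
  have /filter_ex // : p [set x | forall n, (n <= k)%N ->
      ultra_indices c n -> c < `|f n x|].
  apply: filter_forall_leq => n _; have [nJ|nJ] := pselect (ultra_indices c n).
    by apply: filterS nJ.
  exact: nearW.
have [x xP] := choice Fx; exists x => n nJ k nk; exact: xP.
Qed.

End UltrafilterSelection.

(** * Limits along an ultrafilter as positive functionals *)

Section UltrafilterLimit.
Context {S : Type} {R : realType} {U : set_system S} {UU : UltraFilter U}.

Lemma ultra_bounded_cvg (u : S -> R) (M : R) :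
  (forall k, `|u k| <= M) -> cvg (u @ U).
Proof.
move=> uM; have uI : (u @ U) `[- M, M]%classic.
  by apply: nearW => k /=; rewrite in_itv/= -ler_norml.
(* By compactness there is a cluster point, and an ultrafilter converges to its
   cluster points. *)
have [a [_ Ua]] := segment_compact (fmap_proper_filter u ultra_proper) uI.
apply/cvg_ex; exists a => A Aa.
case: (in_ultra_setVsetC (u @^-1` A) UU) => // nA.
by have [y [nAy Ay]] := Ua (~` A) A nA Aa.
Qed.

End UltrafilterLimit.

Section UltrafilterFunctional.
Context {S X : Type} {R : realType} (U : set_system S) {UU : UltraFilter U}.
Variable x : S -> X.

Definition ultra_eval (g : bfun X R) : R := lim (g (x k) @[k --> U]).

Lemma ultra_eval_cvg (g : bfun X R) : g (x k) @[k --> U] --> ultra_eval g.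
Proof.
have [M gM] := bfun_bounded g; apply: (@ultra_bounded_cvg _ _ _ _ _ M) => k.
exact: gM.
Qed.

Arguments ultra_eval_cvg : clear implicits.

Lemma ultra_eval_scalar : scalar ultra_eval.
Proof.
move=> a g h; apply: cvg_lim => //.
exact: (cvgD (cvgM (cvg_cst a) (ultra_eval_cvg g)) (ultra_eval_cvg h)).
Qed.

HB.instance Definition _ :=
  GRing.isLinear.Build R (bfun X R) R *%R ultra_eval ultra_eval_scalar.

Lemma ultra_eval_positive : positive_functional ultra_eval.
Proof.
move=> g g0; apply: limr_ge; first exact: ultra_eval_cvg.
by apply: nearW => k; exact: g0.
Qed.

Lemma ultra_eval_abs_ge (g : bfun X R) (c : R) :
  U [set k | c <= `|g (x k)|] -> c <= `|ultra_eval g|.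
Proof. exact: (cvgr_to_ge (cvg_norm (ultra_eval_cvg g))). Qed.

End UltrafilterFunctional.

(** * The equivalence *)

Theorem corollary2 (R : realType) (X : Type) (f : nat -> bfun X R)
    (hf : uniformly_bounded f) :
  weakly_dcvg0 f <->
  (forall x : nat -> X,
     has_dlim (fun n => limn_inf (fun k => `|f n (x k)|)) 0).
Proof.
have [M M0 fM] := hf.
have ub (x : nat -> X) n : bounded_fun ((fun k => `|f n (x k)|) : nat -> R^o).
  by apply: (@bounded_fun_norm_le _ _ _ M) => k; rewrite normr_id.
split=> [wf x|liminf0 T posT].
  have [U [UU ooU]] := ultraFilterLemma eventually_filter.
  move=> [r [I [r0 I0 Ir]]]; apply: (wf (ultra_eval U x)).
    exact: ultra_eval_positive.
  exists (r / 2), I; split=> //; first by rewrite divr_gt0.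
  move=> n /Ir; rewrite !subr0 ger0_norm; last first.
    by apply: limn_inf_ge_eventually => //; exact: nearW.
  move=> /(limn_inf_gt_eventually (ub x n)) rf.
  apply: (@lt_le_trans _ _ r); first lra.
  apply: ultra_eval_abs_ge; apply: ooU.
  by apply: filterS rf => k /ltW.
move=> [r [I [r0 I0 Ir]]].
have [d d0 dI] := (upper_density_gt0P I).1 I0.
(* [T] of the average is at least the average of [`|T (f n)|], to which each
   [n] in [I] contributes at least [r]. *)
have Tf k : exists2 j, (k <= j)%N & d * r <= T (cesaro_abs f j).
  have [j kj dj] := dI k; exists j => //.
  rewrite /cesaro_abs linearZ/= linear_sum/= [leRHS]mulrC.
  apply: le_trans (ler_wpM2r (ltW r0) dj) _.
  rewrite /freq mulrAC ler_wpM2r ?invr_ge0// mulr_suml; apply: ler_sum => n _.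
  have [/set_mem/Ir|_] := boolP (n \in I).
    rewrite subr0 mul1r => /ltW/le_trans; apply; exact: positive_functional_abs.
  by rewrite mul0r; apply: posT => x /=.
have cM j x : cesaro_abs f j x <= M.
  rewrite cesaro_absE; case: j => [|j]; first by rewrite invr0 mulr0 ltW.
  rewrite ler_pdivrMr//.
  have -> : M * j.+1%:R = \sum_(1 <= k < j.+2) M.
    by rewrite sumr_const_nat subn1 mulr_natr.
  exact: ler_sum.
have [eta eta0 [p [pU pf]]] :=
  positive_functional_reverse_fatou posT cM (mulr_gt0 d0 r0) Tf.
have [x xP] := @ultra_indices_seq _ _ f p pU (eta / 2).
apply: (liminf0 x); exists (eta / 4), (@ultra_indices _ _ f p (eta / 2)); split.
- by rewrite divr_gt0.
- exact: (ultra_indices_density_gt0 M0 fM eta0 pf).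
move=> n nJ; rewrite subr0; apply: lt_le_trans (ler_norm _).
apply: (@lt_le_trans _ _ (eta / 2)); first lra.
apply: limn_inf_ge_eventually => //; exists n => // k /= nk.
exact/ltW/xP.
Qed.
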